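(* Fix $r\ge1$ and $b_1$. Let $\mathbf b=(b_1,\dots,b_r)$ and $\mathbf b'=(b_1',\dots,b_r')$ be two nonincreasing integer sequences with $b_i\ge i$ and $b_i'\ge i$ for all $i$, with $b_1'=b_1$ and $b_i\le b_i'$ for every $i$. Then $$\mathbb{H}_{F_{\mathbf b},\rho}(q,t)\preceq\mathbb{H}_{F_{\mathbf b'},\rho}(q,t),$$ where $A\preceq B$ means $B-A\in\mathbb{N}[q,t]$. More generally, if $x=(i,c)\le y=(j,d)$ are cells common to both $F_{\mathbf b}$ and $F_{\mathbf b'}$, then $$\mathbb{H}_{[x,y]_{\mathbf b},\rho_{x,y}}(q,t)\preceq\mathbb{H}_{[x,y]_{\mathbf b'},\rho_{x,y}}(q,t),$$ where $[x,y]_{\mathbf b}$ and $[x,y]_{\mathbf b'}$ are the intervals in $F_{\mathbf b}$ and $F_{\mathbf b'}$ and $\rho_{x,y}(z)=\rho(z)-\rho(x)$. In particular, for fixed $r$ and $b_1\ge r$, the boundary sequences $(b_1,r,\dots,r)$ and $(b_1,\dots,b_1)$ give coefficientwise lower and upper bounds, respectively, for every boundary of length $r$ with first entry $b_1$.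
   Context: $\mathbb N=\{0,1,2,\dots\}$. $q$-Zeta numerator: let $P$ be a finite graded poset with a unique maximum and rank function $\rho:P\to\{0,\dots,H\}$, where $H$ is the maximal rank. For $m\ge 0$ put $A_m(P,\rho;q)=\sum_{x_1\le\cdots\le x_m}q^{\rho(x_1)+\cdots+\rho(x_m)}$ (sum over weak chains in $P$; $A_0=1$). The numerator $\mathbb{H}_{P,\rho}(q,t)$ is the polynomial determined by $\sum_{m\ge 0}A_m(P,\rho;q)t^m=\mathbb{H}_{P,\rho}(q,t)/\prod_{a=0}^{H}(1-q^at)$. Ferrers-cell poset: for integers $b_1\ge\cdots\ge b_r$ with $b_i\ge i$, $F_{\mathbf b}=\{(i,c):1\le i\le r,\ i\le c\le b_i\}$, ordered by $(i,c)\le(j,d)\iff i\ge j$ and $c\le d$, with rank $\rho(i,c)=c-i$. *)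

(* Defs.v *)
From mathcomp Require Import all_boot all_order all_algebra.

Set Implicit Arguments.
Unset Strict Implicit.
Unset Printing Implicit Defensive.

Import Order.TTheory GRing.Theory Num.Theory.
Local Open Scope ring_scope.

(* Z[q] is {poly int} with q = 'X, and Z[q][t] is {poly {poly int}} with      *)
(* t = 'X and q = 'X%:P.  A finite poset is a subset P of a finPOrderType T   *)
(* with the induced order; its rank function only matters on P.              *)

Definition chain_sum d (T : finPOrderType d) (P : {set T}) (rho : T -> nat)
    (m : nat) : {poly int} :=
  \sum_(s : m.-tuple T | all (mem P) s && sorted <=%O s)
    'X^(\sum_(x <- s) rho x).

Definition max_rank d (T : finPOrderType d) (P : {set T}) (rho : T -> nat)
    : nat :=
  \max_(x in P) rho x.

Definition zeta_den d (T : finPOrderType d) (P : {set T}) (rho : T -> nat)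
    : {poly {poly int}} :=
  \prod_(0 <= a < (max_rank P rho).+1) (1 - ('X^a)%:P * 'X).

(* Coefficient of t^n in the product of p and the formal power series         *)
(* \sum_m (a m) t^m.                                                          *)
Definition series_mul (R : nzRingType) (p : {poly R}) (a : nat -> R) (n : nat)
    : R :=
  \sum_(i < n.+1) p`_i * a (n - i)%N.

(* N = (denominator) * \sum_m (chain_sum P rho m) t^m, in Z[q][[t]].          *)
Definition is_zeta_num d (T : finPOrderType d) (P : {set T}) (rho : T -> nat)
    (N : {poly {poly int}}) : Prop :=
  forall n, N`_n = series_mul (zeta_den P rho) (chain_sum P rho) n.

(* When rho is strictly increasing on P, as any rank function is, the         *)
(* coefficients dropped by this truncation vanish: see zeta_numP.             *)
Definition zeta_num d (T : finPOrderType d) (P : {set T}) (rho : T -> nat)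
    : {poly {poly int}} :=
  \poly_(n < (max_rank P rho).+2)
    series_mul (zeta_den P rho) (chain_sum P rho) n.

(* B - A \in N[q, t].                                                         *)
Definition coef_le (A B : {poly {poly int}}) : Prop :=
  forall i j, (B - A)`_i`_j \is a Num.nat.

Lemma coef_leP (A B : {poly {poly int}}) :
  coef_le A B <-> forall i j, A`_i`_j <= B`_i`_j.
Proof.
have nat_ge0 (n : int) : (n \is a Num.nat) = (0 <= n).
  by rewrite natrEint -{1}[n]intz intr_int.
by split=> AB i j; move: (AB i j); rewrite !coefB nat_ge0 subr_ge0.
Qed.

(* Cells (i, c), with 0 <= i <= r and 0 <= c <= b1; both indices are 1-based  *)
(* in ferrers.  The order is reversed on the first component.                 *)
Notation cell r b1 := (('I_r.+1)^d *p 'I_b1.+1)%type.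

Definition cell_row (r b1 : nat) (x : cell r b1) : nat := (x.1 : 'I_r.+1).
Definition cell_col (r b1 : nat) (x : cell r b1) : nat := x.2.

Lemma le_cell (r b1 : nat) (x y : cell r b1) :
  (x <= y)%O = (cell_row y <= cell_row x)%N && (cell_col x <= cell_col y)%N.
Proof. by []. Qed.

(* 1-based entry of b = (b_1, ..., b_r). *)
Definition entry (b : seq nat) (i : nat) : nat := nth 0%N b i.-1.

(* As b_i >= i, the integers b_i are natural numbers. *)
Definition boundary (r b1 : nat) (b : seq nat) : Prop :=
  [/\ size b = r, entry b 1 = b1, sorted geq b
    & forall i, (1 <= i <= r)%N -> (i <= entry b i)%N].

Definition ferrers (r b1 : nat) (b : seq nat) : {set cell r b1} :=
  [set x : cell r b1 |
    (1 <= cell_row x)%N && (cell_row x <= cell_col x <= entry b (cell_row x))%N].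

Definition cell_rank (r b1 : nat) (x : cell r b1) : nat :=
  (cell_col x - cell_row x)%N.

Definition interval_in d (T : finPOrderType d) (P : {set T}) (x y : T)
    : {set T} :=
  [set z in P | (x <= z <= y)%O].

Definition rel_rank (r b1 : nat) (x z : cell r b1) : nat :=
  (cell_rank z - cell_rank x)%N.

Lemma series_mul_trunc (R : nzRingType) (p : {poly R}) (a : nat -> R) n M :
  (n < M)%N -> series_mul p a n = (p * \poly_(k < M) a k)`_n.
Proof.
move=> ltnM; rewrite coefM; apply: eq_bigr => i _; rewrite coef_poly.
by rewrite (leq_ltn_trans (leq_subr _ _) ltnM).
Qed.

Lemma series_mulM (R : nzRingType) (p q : {poly R}) (a : nat -> R) n :
  series_mul (p * q) a n = series_mul p (series_mul q a) n.
Proof.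
rewrite (@series_mul_trunc _ _ _ n n.+1) // -mulrA coefM.
apply: eq_bigr => i _; rewrite -series_mul_trunc //.
by rewrite ltnS leq_subr.
Qed.

Lemma eq_series_mul (R : nzRingType) (p : {poly R}) (a b : nat -> R) n :
  a =1 b -> series_mul p a n = series_mul p b n.
Proof. by move=> eab; apply: eq_bigr => i _; rewrite eab. Qed.

Lemma series_mul_poly (R : nzRingType) (p q : {poly R}) (a : nat -> R) n :
  (forall k, a k = q`_k) -> series_mul p a n = (p * q)`_n.
Proof. by move=> eaq; rewrite coefM; apply: eq_bigr => i _; rewrite eaq. Qed.

Definition poly_series (R : nzRingType) (e : nat) (a : nat -> R) : Prop :=
  exists2 Q : {poly R}, (size Q <= e)%N & forall n, a n = Q`_n.

Definition chain_sum_from d (T : finPOrderType d) (P : {set T})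
    (rho : T -> nat) (x : T) (m : nat) : {poly int} :=
  \sum_(s : m.-tuple T | all (mem P) s && path <=%O x s)
    'X^(\sum_(y <- s) rho y).

Lemma sum_tupleS (R : nmodType) (T : finType) m (p : pred (seq T))
    (F : seq T -> R) :
  \sum_(s : m.+1.-tuple T | p s) F s =
  \sum_x \sum_(s : m.-tuple T | p (x :: s)) F (x :: s).
Proof.
rewrite pair_big_dep /=.
rewrite (reindex (fun u : T * m.-tuple T => [tuple of u.1 :: u.2])) //=.
exists (fun s : m.+1.-tuple T => (thead s, [tuple of behead s])).
  by move=> [x s] _ /=; rewrite theadE; congr (_, _); apply: val_inj.
by move=> s _; rewrite /= -tuple_eta.
Qed.

Lemma sum_tuple0 (R : nmodType) (T : finType) (p : pred (seq T))
    (F : seq T -> R) :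
  p [::] -> \sum_(s : 0.-tuple T | p s) F s = F [::].
Proof.
move=> p0; rewrite (big_pred1 [tuple]) // => s.
by rewrite [s]tuple0 p0; apply/esym/eqP.
Qed.

Section Existence.
Variables (d : Order.disp_t) (T : finPOrderType d) (P : {set T}).
Variable rho : T -> nat.
Local Notation R := {poly int}.
Local Notation A := (chain_sum P rho).
Local Notation C := (chain_sum_from P rho).
Local Notation H := (max_rank P rho).
Local Notation f a := (1 - ('X^a)%:P * 'X : {poly R}).

Lemma chain_sum0 : A 0 = 1.
Proof.
rewrite /chain_sum (sum_tuple0 (p := fun s => all (mem P) s && sorted <=%O s)
  (fun s => 'X^(\sum_(x <- s) rho x))) //.
by rewrite big_nil expr0.
Qed.

Lemma chain_sum_from0 x : C x 0 = 1.
Proof.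
rewrite /chain_sum_from (sum_tuple0 (p := fun s => all (mem P) s && path <=%O x s)
  (fun s => 'X^(\sum_(y <- s) rho y))) //.
by rewrite big_nil expr0.
Qed.

Lemma chain_sumS m : A m.+1 = \sum_(x in P) 'X^(rho x) * C x m.
Proof.
rewrite /chain_sum (sum_tupleS _ (fun s => all (mem P) s && sorted <=%O s)
  (fun s => 'X^(\sum_(x <- s) rho x))).
rewrite [RHS]big_mkcond; apply: eq_bigr => x _ /=.
case: ifP => xP; last by rewrite big_pred0.
rewrite big_distrr /=; apply: eq_bigr => s _.
by rewrite big_cons exprD.
Qed.

Lemma chain_sum_fromS x m :
  C x m.+1 = \sum_(y in P | (x <= y)%O) 'X^(rho y) * C y m.
Proof.
rewrite {1}/chain_sum_from
  (sum_tupleS _ (fun s => all (mem P) s && path <=%O x s)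
  (fun s => 'X^(\sum_(x <- s) rho x))).
rewrite [RHS]big_mkcond; apply: eq_bigr => y _ /=.
case: (boolP (y \in P)) => yP /=; last by rewrite big_pred0.
case: (boolP (x <= y)%O) => xy /=; last first.
  by rewrite big_pred0 // => s; rewrite andbF.
rewrite big_distrr /=; apply: eq_bigr => s _.
by rewrite big_cons exprD.
Qed.

Lemma size_fprod m n : (size (\prod_(m <= a < n) f a)%R <= (n - m).+1)%N.
Proof.
have [lenm|/ltnW lemn] := leqP n m.
  by rewrite big_geq // size_poly1.
elim: n lemn => [|n IHn] lemn.
  by rewrite big_geq // size_poly1.
have [->|nem] := eqVneq m n.+1; first by rewrite big_geq // size_poly1.
have {lemn nem} lemn : (m <= n)%N by rewrite -ltnS ltn_neqAle nem.
rewrite big_nat_recr //= subSn //.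
apply: (leq_trans (size_polyMleq _ _)).
have sf : (size (f n) <= 2)%N.
  apply: (leq_trans (size_polyD _ _)); rewrite geq_max size_poly1 /= size_polyN.
  by rewrite mul_polyC (leq_trans (size_scale_leq _ _)) // size_polyX.
apply: (leq_trans (n := ((n - m).+1 + 2).-1)); last by rewrite addn2.
by rewrite -!subn1 leq_sub2r // leq_add // IHn.
Qed.

(* a is the series 1 + t * \sum_(y | p y) q^(rho y) * C y. *)
Lemma shift_series (p : pred T) (D : {poly R}) e (a : nat -> R) :
    a 0 = 1 -> (forall m, a m.+1 = \sum_(y | p y) 'X^(rho y) * C y m) ->
    (size D <= e)%N ->
    (forall y, p y -> exists2 Q : {poly R}, ((size Q).+1 <= e)%N &
       forall n, series_mul D (C y) n = Q`_n) ->
  poly_series e (series_mul D a).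
Proof.
move=> a0 aS sD DC.
have [Q QP] : exists Q : T -> {poly R}, forall y, p y ->
    ((size (Q y)).+1 <= e)%N /\ (forall n, series_mul D (C y) n = (Q y)`_n).
  have QP y : exists Q : {poly R}, p y ->
      ((size Q).+1 <= e)%N /\ (forall n, series_mul D (C y) n = Q`_n).
    have [/DC[Q sQ QE]|] := boolP (p y); first by exists Q.
    by exists 0.
  exact: (fin_all_exists QP).
exists (D + \sum_(y | p y) 'X^(rho y) *: (Q y * 'X)).
  apply: (leq_trans (size_polyD _ _)); rewrite geq_max sD /=.
  apply: (leq_trans (size_sum _ _ _)); apply/bigmax_leqP => y py.
  apply: (leq_trans (size_scale_leq _ _)).
  apply: leq_trans (QP y py).1.
  by apply: (leq_trans (size_polyMleq _ _)); rewrite size_polyX addn2.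
move=> n; rewrite coefD coef_sum /series_mul big_ord_recr /= subnn a0 mulr1.
rewrite addrC; congr (_ + _).
case: n => [|n].
  rewrite big_ord0 big1 // => y _.
  by rewrite coefZ coefMX mulr0.
transitivity (\sum_(i < n.+1) \sum_(y | p y) D`_i * ('X^(rho y) * C y (n - i)%N)).
  apply: eq_bigr => i _; rewrite subSn ?aS ?big_distrr //.
  by rewrite -ltnS.
rewrite exchange_big /=; apply: eq_bigr => y py.
rewrite coefZ coefMX /= -(QP y py).2 /series_mul big_distrr /=.
by apply: eq_bigr => i _; rewrite mulrCA.
Qed.

Hypothesis rhoS : {in P &, forall x y, (x < y)%O -> (rho x < rho y)%N}.

Lemma rho_max x : x \in P -> (rho x <= H)%N.
Proof. by move=> xP; exact: (@leq_bigmax_cond _ (fun x => x \in P) rho x xP). Qed.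

Lemma poly_chain_from x : x \in P ->
  poly_series (H - rho x).+1
    (series_mul (\prod_(rho x <= a < H.+1) f a) (C x)).
Proof.
have [k] := ubnP (H - rho x)%N; elim: k x => // k IHk x ltk xP.
have lex := rho_max xP.
set a := series_mul (f (rho x)) (C x).
have a0 : a 0 = 1.
  rewrite /a /series_mul big_ord1 chain_sum_from0 mulr1.
  by rewrite coefB coef1 coefMX subr0.
have aS m : a m.+1 = \sum_(y | (y \in P) && (x < y)%O) 'X^(rho y) * C y m.
  rewrite /a /series_mul big_ord_recl big_ord_recl big1 ?addr0 /=; last first.
    move=> i _; rewrite /bump /= coefB coef1 mul_polyC coefZ coefX /=.
    by rewrite mulr0 subr0 mul0r.
  rewrite !coefB !coef1 !mul_polyC !coefZ !coefX /= mulr0 subr0 mul1r mulr1.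
  rewrite sub0r mulNr subSS !subn0 chain_sum_fromS.
  rewrite (bigD1 x) ?xP ?lexx //= [X in X - _]addrC addrK.
  apply: eq_bigl => y; rewrite lt_neqAle -andbA.
  by congr (_ && _); rewrite andbC eq_sym.
have [Q sQ QE] : poly_series (H - rho x).+1
    (series_mul (\prod_((rho x).+1 <= a < H.+1) f a) a).
  apply: (shift_series a0 aS).
    by apply: (leq_trans (size_fprod _ _)); rewrite subSS.
  move=> y /andP[yP ltxy]; have ltr := rhoS xP yP ltxy.
  have ley := rho_max yP.
  have [|Q sQ QE] := IHk y _ yP.
    apply: leq_trans (ltk : _ <= k)%N.
    by rewrite ltn_sub2l // (leq_trans ltr).
  exists (\prod_((rho x).+1 <= a < rho y) f a * Q).
    rewrite ltnS; apply: (leq_trans (size_polyMleq _ _)).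
    apply: (leq_trans (n := ((rho y - (rho x).+1).+1 + (H - rho y).+1).-1)).
      by rewrite -!subn1 leq_sub2r // leq_add // size_fprod.
    by rewrite addnS /= -subSn // subSS addnC addnBA ?subnK // ltnW.
  move=> n; rewrite (@big_cat_nat _ _ _ (rho y)) //=; last exact: leqW.
  by rewrite series_mulM; apply: series_mul_poly.
exists Q => // n; rewrite -QE big_ltn // mulrC series_mulM.
exact: eq_series_mul.
Qed.

Lemma zeta_num_is : is_zeta_num P rho (zeta_num P rho).
Proof.
have [Q sQ QE] : poly_series H.+2 (series_mul (zeta_den P rho) A).
  apply: (shift_series (p := mem P) chain_sum0 chain_sumS).
    exact: size_fprod.
  move=> y yP; have ley := rho_max yP.
  have [Q sQ QE] := poly_chain_from yP.
  exists (\prod_(0 <= a < rho y) f a * Q).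
    rewrite ltnS; apply: (leq_trans (size_polyMleq _ _)).
    apply: (leq_trans (n := ((rho y).+1 + (H - rho y).+1).-1)).
      rewrite -!subn1 leq_sub2r // leq_add //.
      by have := size_fprod 0 (rho y); rewrite subn0.
    by rewrite addnS /= addSn subnKC.
  move=> n; rewrite /zeta_den (@big_cat_nat _ _ _ (rho y)) //=; last exact: leqW.
  by rewrite series_mulM; apply: series_mul_poly.
move=> n; rewrite coef_poly; case: ltnP => // leHn.
by rewrite QE nth_default // (leq_trans sQ).
Qed.

Lemma zeta_numP (N : {poly {poly int}}) :
  is_zeta_num P rho N <-> N = zeta_num P rho.
Proof.
split=> [NP|->]; last exact: zeta_num_is.
by apply/polyP => n; rewrite NP zeta_num_is.
Qed.

End Existence.

Lemma cell_rank_strict (r b1 : nat) (b : seq nat) :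
  {in ferrers r b1 b &, forall x y : cell r b1,
    (x < y)%O -> (cell_rank x < cell_rank y)%N}.
Proof.
move=> x y; rewrite !inE => /andP[_ /andP[x12 _]] /andP[_ /andP[y12 _]].
rewrite lt_neqAle le_cell => /andP[nexy /andP[le1 le2]].
have [lt1|ge1] := ltnP (cell_row y) (cell_row x).
  apply: (@leq_ltn_trans (cell_col y - cell_row x)%N); first exact: leq_sub2r.
  exact: ltn_sub2l (leq_trans lt1 (leq_trans x12 le2)) lt1.
have e1 : cell_row x = cell_row y by apply/eqP; rewrite eqn_leq ge1.
rewrite /cell_rank -e1 ltn_sub2rE // ltn_neqAle le2 andbT.
apply: contra nexy => /eqP e2.
case: x y e1 e2 {x12 y12 le1 le2 ge1} => [i c] [j k] e1 e2.
have -> : i = j by apply: val_inj.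
by have -> : c = k by apply: val_inj.
Qed.

Lemma ferrers_zeta_numP (r b1 : nat) (b : seq nat) (N : {poly {poly int}}) :
  is_zeta_num (ferrers r b1 b) (@cell_rank r b1) N <->
  N = zeta_num (ferrers r b1 b) (@cell_rank r b1).
Proof. exact/zeta_numP/cell_rank_strict. Qed.

Lemma interval_zeta_numP (r b1 : nat) (b : seq nat) (x y : cell r b1)
    (N : {poly {poly int}}) :
    x \in ferrers r b1 b ->
  is_zeta_num (interval_in (ferrers r b1 b) x y) (rel_rank x) N <->
  N = zeta_num (interval_in (ferrers r b1 b) x y) (rel_rank x).
Proof.
move=> xF; apply: zeta_numP => z w.
rewrite ![in _ \in interval_in _ _ _]in_set.
move=> /andP[zF /andP[xz _]] /andP[wF _] ltzw.
have ltr := cell_rank_strict zF wF ltzw.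
rewrite /rel_rank ltn_sub2r //; apply: leq_ltn_trans ltr.
by move: xz; rewrite le_cell => /andP[? ?]; apply: leq_sub.
Qed.

(* Main.v *)
Require Import Defs.
From mathcomp Require Import all_boot all_order all_algebra.
From mathcomp Require Import zify ring.

(* Cutting a chain at the row of its first element gives, for the generating   *)
(* series C z of the chains above z and E z of those that moreover start in    *)
(* the row of z, the relations C z = C (up z) + E z and                        *)
(* E z = q^(rho z) t C z + E (right z).  Clearing denominators turns them into *)
(* a subtraction-free recursion, so the numerators enumerate the lattice paths *)
(* from z to the top cell by the ranks of their right-then-up corners.         *)
(* Enlarging the boundary only adds such paths.                                *)

Set Implicit Arguments.
Unset Strict Implicit.
Unset Printing Implicit Defensive.

Import Order.TTheory GRing.Theory Num.Theory.
Local Open Scope ring_scope.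

(** Locate each cell by its up- and right-steps to the top cell; these coordinates and the ranks
    they determine are the same for both boundaries. Eliminating between the two relations above
    gives (1 - q^(rho z) t) C z = C (up z) + E (right z) and (1 - q^(rho z) t) E z = q^(rho z) t C
    (up z) + E (right z). Both neighbours have rank rho z + 1, so the remaining factors of the
    denominator clear them exactly, and the cleared C and E are the values of [path_poly] with flag
    [false] and [true] ([path_polyP]). An interval has a least cell x, and its numerator is the
    cleared C x ([zeta_num_path_min]). In the whole poset every row starts at rank zero, and the
    numerator is the sum of the cleared E over the row starts ([zeta_num_path_rows]). The boundary
    enters only through the cells that paths may visit, and path weights are monomials with
    coefficient 1, so a larger boundary adds nonnegative terms ([path_poly_mono]). The extreme
    sequences are bounds because r <= b_r <= b_i <= b_1 for all i. *)

(** * Linearity of the product of a polynomial and a series *)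

Section SeriesMul.
Variable R : nzRingType.
Implicit Types (p q : {poly R}) (a b : nat -> R).

Lemma series_mulDl p q a n :
  series_mul (p + q) a n = series_mul p a n + series_mul q a n.
Proof.
by rewrite -big_split; apply: eq_bigr => i _ /=; rewrite coefD mulrDl.
Qed.

Lemma series_mulNl p a n : series_mul (- p) a n = - series_mul p a n.
Proof.
by rewrite /series_mul -sumrN; apply: eq_bigr => i _; rewrite coefN mulNr.
Qed.

Lemma series_mulDr p a b n :
  series_mul p (fun m => a m + b m) n = series_mul p a n + series_mul p b n.
Proof. by rewrite -big_split; apply: eq_bigr => i _ /=; rewrite mulrDr. Qed.

Lemma series_mulBr p a b n :
  series_mul p (fun m => a m - b m) n = series_mul p a n - series_mul p b n.
Proof.
by rewrite -sumrB; apply: eq_bigr => i _ /=; rewrite mulrBr.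
Qed.

Lemma series_mul_sumr (I : finType) p (a : I -> nat -> R) n :
  series_mul p (fun m => \sum_i a i m) n = \sum_i series_mul p (a i) n.
Proof.
by rewrite exchange_big; apply: eq_bigr => i _ /=; rewrite big_distrr.
Qed.

Lemma series_mul1 a n : series_mul 1 a n = a n.
Proof.
rewrite /series_mul big_ord_recl coef1 mul1r subn0 big1 ?addr0 // => i _.
by rewrite coef1 mul0r.
Qed.

Lemma series_mulCX (c : R) a n :
  series_mul (c%:P * 'X) a n = if n is m.+1 then c * a m else 0.
Proof.
rewrite /series_mul; case: n => [|n].
  by rewrite big_ord1 coefCM coefX mulr0 mul0r.
rewrite 2!big_ord_recl big1 ?addr0 => [|i _].
  by rewrite !coefCM !coefX /= mulr0 mul0r add0r mulr1 subSS subn0.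
by rewrite coefCM coefX mulr0 mul0r.
Qed.

End SeriesMul.

(** * The coefficientwise order *)

Section CoefLe.
Implicit Types A B C D : {poly {poly int}}.

Lemma coef_lexx A : coef_le A A.
Proof. by apply/coef_leP. Qed.

Lemma coef_leD A B C D : coef_le A B -> coef_le C D -> coef_le (A + C) (B + D).
Proof.
move=> /coef_leP AB /coef_leP CD; apply/coef_leP => i j.
by rewrite !coefD lerD.
Qed.

Lemma coef_leM A B C : coef_le 0 C -> coef_le A B -> coef_le (C * A) (C * B).
Proof.
move=> C0 AB i j; rewrite -mulrBr coefM coef_sum; apply: rpred_sum => k _.
rewrite coefM; apply: rpred_sum => l _; apply: rpredM; last exact: AB.
by have := C0 k l; rewrite subr0.
Qed.

Lemma coef_le_sum (I : finType) (F G : I -> {poly {poly int}}) :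
  (forall i, coef_le (F i) (G i)) -> coef_le (\sum_i F i) (\sum_i G i).
Proof.
by move=> FG; apply: big_ind2 => // *; [exact: coef_lexx | exact: coef_leD].
Qed.

Lemma coef_le01 : coef_le 0 1.
Proof.
apply/coef_leP => i j; rewrite !coef0 coef1; case: eqP => _; last by rewrite coef0.
by rewrite coef1; case: eqP.
Qed.

Lemma coef_le0_mono a : coef_le 0 (('X^a)%:P * 'X).
Proof.
apply/coef_leP => i j; rewrite !coef0 coefCM coefX; case: eqP => _.
  by rewrite mulr1 coefXn; case: eqP.
by rewrite mulr0 coef0.
Qed.

End CoefLe.

(** * Lattice-path polynomials and their growth with the region *)

(* A cell is located by the numbers u of up-steps and k of right-steps that    *)
(* separate it from the top cell, so that its rank is H - (u + k).             *)
Section PathPoly.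
Variables (H : nat) (g : nat -> nat -> bool).

(** The recursion along one row, [up] being the already computed row above. An up-step contributes a
    corner exactly when [w] records a preceding right-step. *)
Fixpoint row_poly (up : nat -> {poly {poly int}}) (u : nat) (w : bool) (k : nat)
    : {poly {poly int}} :=
  (if w then ('X^(H - (u + k)))%:P * 'X else 1) * up k +
  (if k is k'.+1 then if g u k' then row_poly up u true k' else 0 else 0).

(* Sum over the lattice paths from (u, k) to the top inside g of the products  *)
(* of q^rank * t over the corners where an up-step follows a right-step; w     *)
(* tells whether (u, k) is reached by a right-step.                            *)
Fixpoint path_poly (w : bool) (u : nat) : nat -> {poly {poly int}} :=
  if u is u'.+1 then row_poly (path_poly false u') u w else fun=> 1.

End PathPoly.

(** Positivity is proved alongside: where [g'] opens a right-step that [g] forbids, the comparison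
    rests on the extra term being nonnegative. *)
Lemma path_poly_mono H (g g' : nat -> nat -> bool) w u k :
  (forall u k, g u k -> g' u k) ->
  coef_le 0 (path_poly H g w u k) /\
  coef_le (path_poly H g w u k) (path_poly H g' w u k).
Proof.
move=> gg'; elim: u => [|u IHu] /= in w k *.
  by split; [exact: coef_le01 | exact: coef_lexx].
have wt0 (v : bool) i :
    coef_le 0 (if v then ('X^i)%:P * 'X else 1 : {poly {poly int}}).
  by case: v; [exact: coef_le0_mono | exact: coef_le01].
have wtM (v : bool) i A B : coef_le A B ->
    coef_le ((if v then ('X^i)%:P * 'X else 1) * A)
            ((if v then ('X^i)%:P * 'X else 1) * B).
  by move=> AB; apply: coef_leM.
have wtM0 (v : bool) i A : coef_le 0 A ->
    coef_le 0 ((if v then ('X^i)%:P * 'X else 1) * A).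
  by move=> /(wtM v i); rewrite mulr0.
elim: k w => [|k IHk] w /=; first last.
  case gk: (g u.+1 k).
    rewrite (gg' _ _ gk); split; last first.
      by apply: coef_leD; [apply/wtM/(IHu _ _).2 | exact: (IHk _).2].
    rewrite -[X in coef_le X]addr0.
    by apply: coef_leD; [apply/wtM0/(IHu _ _).1 | exact: (IHk _).1].
  have h0 : coef_le 0 (if g' u.+1 k then
     row_poly H g' (path_poly H g' false u) u.+1 true k else 0).
    case: ifP => _; last exact: coef_lexx.
    have [h1 h2] := IHk true.
    apply/coef_leP => i j.
    by move/coef_leP: h1 => /(_ i j) h1; move/coef_leP: h2 => /(_ i j); apply: le_trans.
  split; first by rewrite addr0; apply/wtM0/(IHu _ _).1.
  by apply: coef_leD => //; apply/wtM/(IHu _ _).2.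
rewrite !addr0; split; first by apply/wtM0/(IHu _ _).1.
by apply/wtM/(IHu _ _).2.
Qed.

(** * From chain sums to lattice paths *)

Section PlanarPoset.
Variables (d : Order.disp_t) (T : finPOrderType d) (P : {set T}).
Variables (U K rho : T -> nat) (H : nat).
(** These hypotheses hold for Ferrers posets and their intervals alike: a top cell, a cell above
    each cell outside the top row, and rows without gaps. *)
Hypothesis leUK :
  {in P &, forall x y : T, (x <= y)%O = (U y <= U x)%N && (K y <= K x)%N}.
Hypothesis rhoE : {in P, forall z, (rho z + (U z + K z) = H)%N}.
Hypothesis has_top : exists2 z, z \in P & U z = 0%N /\ K z = 0%N.
Hypothesis has_up : {in P, forall z u, U z = u.+1 ->
  exists2 y, y \in P & U y = u /\ K y = K z}.
Hypothesis has_right : {in P &, forall z y, U y = U z -> (K y < K z)%N ->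
  exists2 x, x \in P & U x = U z /\ K z = (K x).+1}.

Local Notation C := (chain_sum_from P rho).
Local Notation f a := (1 - ('X^a)%:P * 'X : {poly {poly int}}).

Definition position (u k : nat) : bool :=
  [exists z in P, (U z == u) && (K z == k)].

Local Notation W := (path_poly H position).

(* Chains from z whose first element lies in the row of z; the empty chain is  *)
(* counted in the top row only, so that the rows partition all the chains.     *)
Definition row_sum (z : T) (m : nat) : {poly int} :=
  if m is m'.+1 then
    \sum_(y in P | (U y == U z) && (K y <= K z)%N) 'X^(rho y) * C y m'
  else (U z == 0%N)%:R.

Lemma max_rankE : max_rank P rho = H.
Proof.
apply/eqP; rewrite eqn_leq; apply/andP; split.
  by apply/bigmax_leqP => z /rhoE <-; apply: leq_addr.
case: has_top => z zP [Uz Kz]; have := rhoE zP; rewrite Uz Kz !addn0 => <-.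
exact: (@leq_bigmax_cond _ (fun x => x \in P) rho z zP).
Qed.

Lemma position_inj x y : x \in P -> y \in P -> U x = U y -> K x = K y -> x = y.
Proof. by move=> xP yP eU eK; apply/le_anti; rewrite !leUK // eU eK !leqnn. Qed.

Lemma chain_sum_row0 z m : z \in P -> U z = 0%N -> C z m = row_sum z m.
Proof.
move=> zP Uz; case: m => [|m]; first by rewrite chain_sum_from0 /= Uz.
rewrite chain_sum_fromS; apply: eq_bigl => y.
by case yP: (y \in P); rewrite //= leUK // Uz leqn0.
Qed.

(** A nonempty chain from [z] starts either in the row of [z] or strictly above it, hence above [y].
    The empty chain is counted by [C y] alone. *)
Lemma chain_sum_up z y m : z \in P -> y \in P -> U z = (U y).+1 -> K y = K z ->
  C z m = C y m + row_sum z m.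
Proof.
move=> zP yP eU eK; case: m => [|m]; first by rewrite !chain_sum_from0 /= eU addr0.
rewrite !chain_sum_fromS (bigID (fun x => U x <= U y)%N) /=.
congr (_ + _); apply: eq_bigl => x; case xP: (x \in P); rewrite //= !leUK // eU ?eK.
  by case: (leqP (U x) (U y)) => h; rewrite ?andbF ?andbT // leqW.
by rewrite -ltnNge andbAC -eqn_leq.
Qed.

(** The first element is either [z] itself, followed by any chain from [z], or a cell further
    right. *)
Lemma row_sum_right z x m : z \in P -> x \in P -> U x = U z -> K z = (K x).+1 ->
  row_sum z m = series_mul (('X^(rho z))%:P * 'X) (C z) m + row_sum x m.
Proof.
move=> zP xP eU eK; rewrite series_mulCX; case: m => [|m] /=; first by rewrite eU add0r.
rewrite (bigD1 z) /= ?zP ?eqxx ?leqnn //; congr (_ + _); apply: eq_bigl => y.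
case yP: (y \in P) => //=; rewrite eU eK; case: eqP => //= eUy.
rewrite leq_eqVlt ltnS -eK; case: (eqVneq (K y) (K z)) => eKy /=; last first.
  by case: (eqVneq y z) eKy => [->|]; rewrite ?eqxx ?andbT.
by rewrite (position_inj yP zP eUy eKy) eqxx eK ltnn.
Qed.

Lemma row_sum_last z m : z \in P ->
    (forall y, y \in P -> U y = U z -> (K z <= K y)%N) ->
  row_sum z m = series_mul (('X^(rho z))%:P * 'X) (C z) m +
                (if m is 0 then (U z == 0%N)%:R else 0).
Proof.
move=> zP zlast; rewrite series_mulCX; case: m => [|m] /=; first by rewrite add0r.
rewrite (big_pred1 z) ?addr0 // => y /=.
case yP: (y \in P) => /=; last by apply/esym/eqP => eyz; rewrite eyz zP in yP.
apply/idP/eqP => [/andP[/eqP eU leK]|->]; last by rewrite eqxx leqnn.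
by apply: position_inj => //; apply/eqP; rewrite eqn_leq leK zlast.
Qed.

Lemma prod_rank_recl z : z \in P ->
  \prod_(rho z <= a < H.+1) f a =
  (\prod_((rho z).+1 <= a < H.+1) f a) * f (rho z).
Proof. by move=> /rhoE eH; rewrite big_ltn 1?mulrC // ltnS -eH leq_addr. Qed.

(** Here [a] is what remains of [row_sum z] without the chains starting at [z]: the row sum of the
    right neighbour, or only the empty-chain term if there is none. *)
Lemma row_sum_path z : z \in P ->
    (forall x, x \in P -> (U x + K x < U z + K z)%N -> forall n,
      series_mul (\prod_(rho x <= a < H.+1) f a) (row_sum x) n
      = (W true (U x) (K x))`_n) ->
  exists2 a, row_sum z =1 fun n => series_mul (('X^(rho z))%:P * 'X) (C z) n + a n &
    forall n, series_mul (\prod_((rho z).+1 <= a < H.+1) f a) a n =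
      (if U z == 0%N then 1 else if K z is k.+1 then
         if position (U z) k then W true (U z) k else 0 else 0)`_n.
Proof.
move=> zP IHz.
have [/existsP[y /and3P[yP /eqP eU ltK]]|noright] :=
    boolP [exists y in P, (U y == U z) && (K y < K z)%N].
  have [x xP [eUx eKx]] := has_right zP yP eU ltK.
  exists (row_sum x) => [n|n]; first exact: row_sum_right.
  have -> : (rho z).+1 = rho x by have := rhoE zP; have := rhoE xP; lia.
  rewrite IHz // ?eKx ?eUx ?addnS //; case: eqP => [-> //|_].
  suff -> : position (U z) (K x) by [].
  by apply/existsP; exists x; rewrite xP eUx !eqxx.
have zlast y : y \in P -> U y = U z -> (K z <= K y)%N.
  move=> yP eU; rewrite leqNgt; apply: contra noright => ltK.
  by apply/existsP; exists y; rewrite yP eU eqxx.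
exists (fun m => if m is 0 then (U z == 0%N)%:R else 0) => [n|n].
  exact: row_sum_last.
rewrite (@series_mul_poly _ _ (U z == 0%N)%:R); last first.
  by case=> [|m]; rewrite coefMn coef1 /= ?mulr1n ?mul0rn.
case: eqP => [Uz0|_]; last first.
  rewrite mulr0; case eK: (K z) => [|k] //; case: ifP => // /existsP[y].
  by case/and3P=> yP /eqP eU /eqP eKy; have := zlast y yP eU; rewrite eK eKy ltnn.
(* The last cell of the top row is the top cell: its rank is [H], the product is empty, and the 1 is
   the empty chain. *)
have [y yP [Uy0 Ky0]] := has_top.
have := zlast y yP; rewrite Uy0 Uz0 Ky0 leqn0 => /(_ erefl) /eqP Kz0.
have := rhoE zP; rewrite Uz0 Kz0 !addn0 => ->.
by rewrite big_geq // mulr1.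
Qed.

(** Induction on the distance to the top cell, for both series at once since each recursion involves
    both. *)
Lemma path_polyP z : z \in P ->
  (forall n, series_mul (\prod_(rho z <= a < H.+1) f a) (row_sum z) n
             = (W true (U z) (K z))`_n) /\
  (forall n, series_mul (\prod_(rho z <= a < H.+1) f a) (C z) n
             = (W false (U z) (K z))`_n).
Proof.
have [s] := ubnP (U z + K z); elim: s z => // s IHs z lts zP.
have [|a az aR] := @row_sum_path z zP.
  by move=> x xP ltx n; have [] := IHs x _ xP; [lia | move=> ->].
rewrite prod_rank_recl //.
case eU: (U z) => [|u]; rewrite eU /= in aR.
  (* In the top row the two series coincide, so one computation serves both flags. *)
  suff CW n : series_mul (\prod_((rho z).+1 <= a < H.+1) f a * f (rho z)) (C z) n
              = (1 : {poly {poly int}})`_n.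
    by split=> n //; rewrite -(@eq_series_mul _ _ (C z)) // => m; exact: chain_sum_row0.
  rewrite series_mulM -aR; apply: eq_series_mul => m.
  rewrite series_mulDl series_mul1 series_mulNl chain_sum_row0 // az.
  by rewrite addrAC subrr add0r.
have [y yP [eUy eKy]] := has_up zP eU.
have [_] := IHs y ltac:(lia) yP.
have erho : rho y = (rho z).+1 by have := rhoE zP; have := rhoE yP; lia.
have eH : (H - (u.+1 + K z) = rho z)%N by have := rhoE zP; lia.
rewrite erho eUy eKy => CyW.
have Cz m : C z m = C y m + row_sum z m.
  by apply: chain_sum_up; rewrite // eUy eU.
(* The term subtracted by the factor is the one that [row_sum z] contributes, so no minus sign
   survives. *)
have fC m : series_mul (f (rho z)) (C z) m = C y m + a m.
  rewrite series_mulDl series_mul1 series_mulNl Cz az; ring.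
have fE m : series_mul (f (rho z)) (row_sum z) m =
            series_mul (('X^(rho z))%:P * 'X) (C y) m + a m.
  (* Writing the row sum as [C z - C y] cancels [C y], leaving the corner term. *)
  have -> : series_mul (f (rho z)) (row_sum z) m =
            series_mul (f (rho z)) (fun i => C z i - C y i) m.
    by apply: eq_series_mul => i; rewrite Cz addrAC subrr add0r.
  rewrite series_mulBr fC series_mulDl series_mul1 series_mulNl; ring.
have WE w : W w u.+1 (K z) =
    (if w then ('X^(rho z))%:P * 'X else 1) * W false u (K z) +
    (if K z is k.+1 then if position u.+1 k then W true u.+1 k else 0 else 0).
  by rewrite -eH /=; case: (K z).
split=> n; rewrite series_mulM WE coefD -aR.
  rewrite (eq_series_mul _ _ fE) series_mulDr -series_mulM mulrC series_mulM.
  by rewrite (series_mul_poly _ _ CyW).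
by rewrite (eq_series_mul _ _ fC) series_mulDr CyW mul1r.
Qed.

Lemma rho_strict : {in P &, forall x y, (x < y)%O -> (rho x < rho y)%N}.
Proof.
move=> x y xP yP; rewrite lt_neqAle leUK // => /and3P[nexy leU leK].
have := rhoE xP; have := rhoE yP; case: (eqVneq (U x) (U y)) => eU; last by lia.
suff: K x != K y by lia.
by apply: contra nexy => /eqP eK; apply/eqP/position_inj.
Qed.

Lemma zeta_num_path_min x : x \in P -> {in P, forall z, (x <= z)%O} ->
  rho x = 0%N -> zeta_num P rho = W false (U x) (K x).
Proof.
move=> xP xmin rx0; apply/esym/zeta_numP; first exact: rho_strict.
move=> n; rewrite -(path_polyP xP).2 rx0 /zeta_den max_rankE.
apply: eq_series_mul => -[|m]; first by rewrite chain_sum0 chain_sum_from0.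
rewrite chain_sumS chain_sum_fromS; apply: eq_bigl => y.
by case yP: (y \in P); rewrite //= xmin.
Qed.

(** Chains are sorted by the row of their first element. As [x i] has rank zero, no cell of its row
    lies to its left, so [row_sum (x i)] sees the whole row; the empty chain goes to row 0. *)
Lemma zeta_num_path_rows r (x : 'I_r -> T) :
    (forall i, [/\ x i \in P, U (x i) = i & rho (x i) = 0%N]) ->
    {in P, forall z, (U z < r)%N} ->
  zeta_num P rho = \sum_(i < r) W true i (K (x i)).
Proof.
move=> xP Ur; apply/esym/zeta_numP; first exact: rho_strict.
move=> n; rewrite coef_sum /zeta_den max_rankE.
rewrite (@eq_series_mul _ _ _ (fun m => \sum_i row_sum (x i) m)); last first.
  case=> [|m].
    have [y yP [Uy _]] := has_top.
    have r0 : (0 < r)%N by rewrite -Uy Ur.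
    rewrite chain_sum0 (bigD1 (Ordinal r0)) //= big1 => [|i ni0].
      by case: (xP (Ordinal r0)) => _ -> _; rewrite eqxx addr0.
    by case: (xP i) => _ -> _; rewrite (negbTE (ni0 : (i : nat) != 0%N)).
  rewrite chain_sumS /= (exchange_big_dep (mem P)) /=; last by move=> i y _ /andP[].
  apply: eq_bigr => y yP; rewrite (big_pred1 (Ordinal (Ur y yP))) // => i /=.
  case: (xP i) => xiP eU erho; rewrite yP eU /= -val_eqE /= eq_sym.
  case: eqP => //= eUy; have := rhoE yP; have := rhoE xiP; rewrite eU erho; lia.
rewrite series_mul_sumr; apply: eq_bigr => i _.
by case: (xP i) => xiP eU erho; have := (path_polyP xiP).1 n; rewrite eU erho.
Qed.

End PlanarPoset.

Lemma position_mono d (T : finPOrderType d) (P P' : {set T}) (U K : T -> nat) :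
  P \subset P' -> forall u k, position P U K u k -> position P' U K u k.
Proof.
move=> sPP' u k /existsP[z /andP[zP zuk]].
by apply/existsP; exists z; rewrite (subsetP sPP') ?zP.
Qed.

(** * Ferrers posets, their intervals and the extreme boundaries *)

Section Ferrers.
Variables (r b1 : nat).
Implicit Types (b : seq nat) (x y z : cell r b1).

Definition ups y z : nat := (cell_row z - cell_row y)%N.
Definition rights y z : nat := (cell_col y - cell_col z)%N.

Lemma cellP i c : (i <= r)%N -> (c <= b1)%N ->
  exists x, cell_row x = i /\ cell_col x = c.
Proof.
move=> ir cb.
by exists ((inord i : 'I_r.+1), (inord c : 'I_b1.+1)); split; apply: inordK.
Qed.

Lemma cell_row_le x : (cell_row x <= r)%N.
Proof. by rewrite -ltnS; apply: ltn_ord. Qed.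

Lemma cell_col_le x : (cell_col x <= b1)%N.
Proof. by rewrite -ltnS; apply: ltn_ord. Qed.

Lemma boundary_entry_le b i j : boundary r b1 b -> (1 <= i <= j)%N ->
  (j <= r)%N -> (entry b j <= entry b i)%N.
Proof.
case=> sb _ sorted_b _ /andP[i1 ij] jr.
have geq_trans : transitive geq by move=> m n p /=; lia.
by apply: (sorted_leq_nth geq_trans leqnn 0%N sorted_b); rewrite ?inE; lia.
Qed.

Lemma ferrersP b x :
  reflect [/\ (1 <= cell_row x)%N, (cell_row x <= cell_col x)%N
            & (cell_col x <= entry b (cell_row x))%N]
          (x \in ferrers r b1 b).
Proof. by rewrite inE; apply: (iffP and3P). Qed.

Section TopCell.
Variables (b : seq nat) (bP : boundary r b1 b) (y : cell r b1) (P : {set cell r b1}).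
Hypothesis PF : P \subset ferrers r b1 b.
Hypothesis yP : y \in P.
Hypothesis ymax : {in P, forall z, (z <= y)%O}.
Hypothesis Pconvex : {in P, forall w z,
  z \in ferrers r b1 b -> (w <= z <= y)%O -> z \in P}.

Lemma le_ups_rights : {in P &, forall w z,
  (w <= z)%O = (ups y z <= ups y w)%N && (rights y z <= rights y w)%N}.
Proof.
clear -ymax => w z /ymax wy /ymax; move: wy; rewrite !le_cell /ups /rights; lia.
Qed.

Lemma has_top_cell : exists2 z, z \in P & ups y z = 0%N /\ rights y z = 0%N.
Proof. by exists y => //; rewrite /ups /rights !subnn. Qed.

(** The boundary is nonincreasing: a column allowed in one row is allowed in the row above. *)
Lemma has_up_cell : {in P, forall z u, ups y z = u.+1 ->
  exists2 x, x \in P & ups y x = u /\ rights y x = rights y z}.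
Proof.
move=> z zP u; rewrite /ups /rights => eu.
have /ferrersP[z1 z2 z3] := subsetP PF z zP.
have /ferrersP[y1 y2 y3] := subsetP PF y yP.
have := ymax zP; rewrite le_cell => /andP[le1 le2].
have [x [x1 x2]] : exists x, cell_row x = (cell_row z).-1 /\ cell_col x = cell_col z.
  by apply: cellP; [have := cell_row_le z; lia | exact: cell_col_le].
exists x; last by rewrite x1 x2; lia.
apply: (Pconvex zP); last by rewrite !le_cell x1 x2; lia.
apply/ferrersP; rewrite x1 x2; split; [lia | lia | apply: (leq_trans z3)].
by apply: boundary_entry_le => //; [lia | exact: cell_row_le].
Qed.

Lemma has_right_cell : {in P &, forall z w, ups y w = ups y z ->
  (rights y w < rights y z)%N ->
  exists2 x, x \in P & ups y x = ups y z /\ rights y z = (rights y x).+1}.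
Proof.
move=> z w zP wP; rewrite /ups /rights => eU ltK.
have /ferrersP[z1 z2 z3] := subsetP PF z zP.
have /ferrersP[w1 w2 w3] := subsetP PF w wP.
have := ymax zP; have := ymax wP; rewrite !le_cell => /andP[lew1 lew2] /andP[lez1 lez2].
have ewz : cell_row w = cell_row z by lia.
have [x [x1 x2]] : exists x, cell_row x = cell_row z /\ cell_col x = (cell_col z).+1.
  by apply: cellP; [exact: cell_row_le | have := cell_col_le w; lia].
exists x; last by rewrite x1 x2; lia.
apply: (Pconvex zP); last by rewrite !le_cell x1 x2; lia.
by apply/ferrersP; rewrite x1 x2; split; rewrite -?ewz; lia.
Qed.

End TopCell.

(** The top cell is (1, b1), of rank b1 - 1, and the rows start at the diagonal cells (i+1, i+1),
    which lie [i] up-steps and b1 - (i+1) right-steps away from it. Only [position] depends on the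
    boundary. *)
Lemma ferrers_zeta_num_path b : (0 < r)%N -> boundary r b1 b ->
  exists2 y : cell r b1, cell_row y = 1%N /\ cell_col y = b1 &
  zeta_num (ferrers r b1 b) (@cell_rank r b1) =
  \sum_(i < r) path_poly b1.-1 (position (ferrers r b1 b) (ups y) (rights y))
    true i (b1 - i.+1).
Proof.
move=> r0 bP; have [sb eb1 _ bi] := bP.
have b1_gt0 : (0 < b1)%N by rewrite -eb1 (bi 1%N) // r0.
have [y [y1 y2]] := cellP r0 (leqnn b1); exists y => //.
have yF : y \in ferrers r b1 b by apply/ferrersP; rewrite y1 y2 eb1; split.
have ymax : {in ferrers r b1 b, forall z, (z <= y)%O}.
  move=> z /ferrersP[z1 _ _]; rewrite le_cell y1 y2 z1; exact: cell_col_le.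
have Fconvex : {in ferrers r b1 b, forall w z,
  z \in ferrers r b1 b -> (w <= z <= y)%O -> z \in ferrers r b1 b} by [].
have diag (i : 'I_r) : exists x : cell r b1, cell_row x = i.+1 /\ cell_col x = i.+1.
  apply: cellP => //; have ir := ltn_ord i.
  apply: (leq_trans (bi i.+1 _)); first by rewrite ir.
  by rewrite -[X in (_ <= X)%N]eb1; apply: boundary_entry_le.
have [x xE] := fin_all_exists diag.
rewrite (zeta_num_path_rows (le_ups_rights ymax) _ (has_top_cell yF)
  (has_up_cell bP (subxx _) yF ymax Fconvex)
  (has_right_cell (subxx _) yF ymax Fconvex) (H := b1.-1) (x := x)).
- by apply: eq_bigr => i _; rewrite /rights (xE i).2 y2.
- move=> z /ferrersP[z1 z2 z3]; rewrite /cell_rank /ups /rights y1 y2.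
  have := cell_col_le z; lia.
- move=> i; have [x1 x2] := xE i; split; last by rewrite /cell_rank x1 x2 subnn.
    by apply/ferrersP; rewrite x1 x2; split=> //; apply: bi; exact: ltn_ord.
  by rewrite /ups x1 y1 subn1.
- move=> z /ferrersP[z1 _ _]; rewrite /ups y1; have := cell_row_le z; lia.
Qed.

Lemma interval_zeta_num_path b x y : boundary r b1 b ->
    x \in ferrers r b1 b -> y \in ferrers r b1 b -> (x <= y)%O ->
  zeta_num (interval_in (ferrers r b1 b) x y) (rel_rank x) =
  path_poly (cell_rank y - cell_rank x)
    (position (interval_in (ferrers r b1 b) x y) (ups y) (rights y))
    false (ups y x) (rights y x).
Proof.
move=> bP xF yF xy; set P := interval_in _ _ _.
have PF : P \subset ferrers r b1 b by apply/subsetP => z; rewrite in_set => /andP[].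
have xP : x \in P by rewrite in_set xF lexx.
have yP : y \in P by rewrite in_set yF xy lexx.
have ymax : {in P, forall z, (z <= y)%O} by move=> z; rewrite in_set => /and3P[].
have Pconvex : {in P, forall w z,
    z \in ferrers r b1 b -> (w <= z <= y)%O -> z \in P}.
  move=> w; rewrite in_set => /and3P[_ xw _] z zF /andP[wz zy].
  by rewrite in_set zF zy (le_trans xw wz).
apply: (zeta_num_path_min (le_ups_rights ymax) _ (has_top_cell yP)
  (has_up_cell bP PF yP ymax Pconvex) (has_right_cell PF yP ymax Pconvex)) => //.
- move=> z; rewrite in_set => /and3P[/ferrersP[z1 z2 _]].
  have /ferrersP[x1 x2 _] := xF; have /ferrersP[y1 y2 _] := yF.
  rewrite !le_cell /rel_rank /cell_rank /ups /rights; lia.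
- by move=> z; rewrite in_set => /and3P[].
- by rewrite /rel_rank subnn.
Qed.

Lemma ferrers_sub b b' :
  (forall i, (1 <= i <= r)%N -> (entry b i <= entry b' i)%N) ->
  ferrers r b1 b \subset ferrers r b1 b'.
Proof.
move=> lebb'; apply/subsetP => z /ferrersP[z1 z2 z3]; apply/ferrersP; split=> //.
by apply: (leq_trans z3); apply: lebb'; rewrite z1 cell_row_le.
Qed.

Lemma ferrers_zeta_num_mono b b' : (0 < r)%N ->
    boundary r b1 b -> boundary r b1 b' ->
    (forall i, (1 <= i <= r)%N -> (entry b i <= entry b' i)%N) ->
  coef_le (zeta_num (ferrers r b1 b) (@cell_rank r b1))
          (zeta_num (ferrers r b1 b') (@cell_rank r b1)).
Proof.
move=> r0 bP b'P /ferrers_sub sub.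
have [y [y1 y2] ->] := ferrers_zeta_num_path r0 bP.
have [y' [y'1 y'2] ->] := ferrers_zeta_num_path r0 b'P.
apply: coef_le_sum => i.
(* Both top cells are (1, b1), so they define the same coordinates. *)
have -> : position (ferrers r b1 b') (ups y') (rights y') =
          position (ferrers r b1 b') (ups y) (rights y).
  by rewrite /position /ups /rights y1 y2 y'1 y'2.
exact: (path_poly_mono _ _ _ _ (position_mono sub)).2.
Qed.

Lemma interval_zeta_num_mono b b' x y :
    boundary r b1 b -> boundary r b1 b' ->
    (forall i, (1 <= i <= r)%N -> (entry b i <= entry b' i)%N) ->
    x \in ferrers r b1 b -> y \in ferrers r b1 b -> (x <= y)%O ->
  coef_le (zeta_num (interval_in (ferrers r b1 b) x y) (rel_rank x))
          (zeta_num (interval_in (ferrers r b1 b') x y) (rel_rank x)).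
Proof.
move=> bP b'P /ferrers_sub sub xF yF xy.
rewrite !interval_zeta_num_path //; try exact: (subsetP sub).
apply: (path_poly_mono _ _ _ _ (position_mono _)).2.
by rewrite /interval_in !setIdE; apply: setSI.
Qed.

Lemma boundary_nseq_min : (0 < r)%N -> (r <= b1)%N ->
  boundary r b1 (b1 :: nseq r.-1 r).
Proof.
move=> r0 rb1; split=> //=; first by rewrite size_nseq prednK.
  by case: r.-1 => //= n; rewrite rb1 /=; elim: n => //= n ->; rewrite leqnn.
case=> [|[|i]] //=; first by rewrite /entry /=; lia.
by rewrite /entry /= nth_nseq => ir; case: ifP; lia.
Qed.

Lemma boundary_nseq_max : (0 < r)%N -> (r <= b1)%N -> boundary r b1 (nseq r b1).
Proof.
move=> r0 rb1; split; rewrite ?size_nseq //.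
- by rewrite /entry nth_nseq r0.
- by case: {+}r => //= n; elim: n => //= n ->; rewrite leqnn.
- by move=> i ir; rewrite /entry nth_nseq; case: ifP; lia.
Qed.

End Ferrers.

Theorem corollary5p14 (r b1 : nat) (r_gt0 : (0 < r)%N) :
  (forall b b' : seq nat,
     boundary r b1 b -> boundary r b1 b' ->
     (forall i : nat, (1 <= i <= r)%N -> (entry b i <= entry b' i)%N) ->
     coef_le (zeta_num (ferrers r b1 b) (@cell_rank r b1))
             (zeta_num (ferrers r b1 b') (@cell_rank r b1))
     /\
     (forall x y : cell r b1,
        x \in ferrers r b1 b -> x \in ferrers r b1 b' ->
        y \in ferrers r b1 b -> y \in ferrers r b1 b' ->
        (x <= y)%O ->
        coef_le (zeta_num (interval_in (ferrers r b1 b) x y) (rel_rank x))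
                (zeta_num (interval_in (ferrers r b1 b') x y) (rel_rank x))))
  /\
  ((r <= b1)%N ->
     let b_min := b1 :: nseq r.-1 r in
     let b_max := nseq r b1 in
     [/\ boundary r b1 b_min, boundary r b1 b_max
       & forall b : seq nat, boundary r b1 b ->
           coef_le (zeta_num (ferrers r b1 b_min) (@cell_rank r b1))
                   (zeta_num (ferrers r b1 b) (@cell_rank r b1))
           /\
           coef_le (zeta_num (ferrers r b1 b) (@cell_rank r b1))
                   (zeta_num (ferrers r b1 b_max) (@cell_rank r b1))]).
Proof.
split=> [b b' bP b'P lebb'|rb1 b_min b_max].
  split; first exact: ferrers_zeta_num_mono.
  by move=> x y xF _ yF _ xy; exact: interval_zeta_num_mono.
have minP := boundary_nseq_min r_gt0 rb1.
have maxP := boundary_nseq_max r_gt0 rb1.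
split=> // b bP; have [_ eb1 _ bi] := bP.
split; apply: ferrers_zeta_num_mono => // i ir; last first.
  rewrite {2}/entry nth_nseq; case: ifP => [_|]; last by lia.
  by rewrite -[X in (_ <= X)%N]eb1; apply: boundary_entry_le bP _ _; lia.
have [i1|i1] := eqVneq i 1%N; first by rewrite i1 eb1.
(* By monotonicity b_i >= b_r, and b_r >= r. *)
have le_r : (r <= entry b i)%N.
  apply: (leq_trans (bi r _)); first by rewrite r_gt0 leqnn.
  by apply: boundary_entry_le bP _ _; lia.
apply: leq_trans le_r; case: i i1 ir => [|[|i]] //= _ ir.
by rewrite /entry /= nth_nseq; case: ifP.
Qed.
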